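(* Let $M_-,M_+\in\mathbb{Z}$ with $M:=M_-+M_+\geq 2$. Define the rational functions $$\sigma_{R_1,M_-,M_+,1,0}(\xi):=\frac{\alpha_{R_1,M_-,M_+,-M_-}(\xi)}{\alpha_{R_1,M_-,M_+-1,-M_-}(\xi)},\qquad \sigma_{R_1,M_-,M_+,1,1}(\xi):=\frac{\alpha_{R_1,M_-,M_+,M_+}(\xi)}{\alpha_{R_1,M_--1,M_+,M_+}(\xi)} .$$ Then: (a) $$\sigma_{R_1,M_-,M_+,1,0}(\xi)=\frac{\lambda_{R_1,M_--1,M_+,M}(\xi)}{\lambda_{R_1,M_--1,M_+,M}(\xi)-\lambda_{R_1,M_-,M_+-1,M}(\xi)},\quad \sigma_{R_1,M_-,M_+,1,1}(\xi)=\frac{\lambda_{R_1,M_-,M_+-1,M}(\xi)}{\lambda_{R_1,M_-,M_+-1,M}(\xi)-\lambda_{R_1,M_--1,M_+,M}(\xi)};$$ (b) $\sigma_{R_1,M_-,M_+,1,0}(\xi)+\sigma_{R_1,M_-,M_+,1,1}(\xi)=1$; (c) for all $\xi\in\mathbb{R}$, $x_i\in\mathbb{R}$, $\Delta x>0$ and $f:\mathbb{R}\to\mathbb{R}$, $$p_{R_1,M_-,M_+}(x_i+\xi\Delta x;x_i,\Delta x;f)=\frac{\lambda_{R_1,M_--1,M_+,M}(\xi)\,p_{R_1,M_-,M_+-1}(x_i+\xi\Delta x;x_i,\Delta x;f)-\lambda_{R_1,M_-,M_+-1,M}(\xi)\,p_{R_1,M_--1,M_+}(x_i+\xi\Delta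 x;x_i,\Delta x;f)}{\lambda_{R_1,M_--1,M_+,M}(\xi)-\lambda_{R_1,M_-,M_+-1,M}(\xi)},$$ where the quotient is understood as the polynomial in $\xi$ obtained by exact polynomial division of the numerator by the denominator; (d) for all $\xi\in\mathbb{R}\setminus\{\xi\in\mathbb{R}:\alpha_{R_1,M_--1,M_+,M_+}(\xi)=0\}$, $x_i\in\mathbb{R}$, $\Delta x>0$ and $f:\mathbb{R}\to\mathbb{R}$, $$p_{R_1,M_-,M_+}(x_i+\xi\Delta x;x_i,\Delta x;f)=\sigma_{R_1,M_-,M_+,1,0}(\xi)\,p_{R_1,M_-,M_+-1}(x_i+\xi\Delta x;x_i,\Delta x;f)+\sigma_{R_1,M_-,M_+,1,1}(\xi)\,p_{R_1,M_--1,M_+}(x_i+\xi\Delta x;x_i,\Delta x;f);$$ (e) the functions $\sigma_{R_1,M_-,M_+,1,0}$ and $\sigma_{R_1,M_-,M_+,1,1}$ on $\mathbb{R}\setminus\{\xi:\alpha_{R_1,M_--1,M_+,M_+}(\xi)=0\}$ satisfying (b) and (d) are unique.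
   Context: For integers $N_\pm$ (of either sign) with $N:=N_-+N_+\ge0$ and $\ell\in\{-N_-,\dots,N_+\}$, put $$\alpha_{I,N_-,N_+,\ell}(\xi)=\prod_{k=-N_-,\,k\neq\ell}^{N_+}\frac{\xi-k}{\ell-k}=\sum_{m=0}^{N}a^{N_-,N_+}_{m,\ell}\,\xi^m ,$$ which defines the coefficients $a^{N_-,N_+}_{m,\ell}$. The fundamental polynomials of Lagrange reconstruction are $$\alpha_{R_1,N_-,N_+,\ell}(\xi):=\sum_{m=0}^{N}\Bigl(\sum_{k=0}^{\lfloor (N-m)/2\rfloor}\frac{\tau_{2k}\,(m+2k)!}{m!}\,a^{N_-,N_+}_{m+2k,\ell}\Bigr)\xi^m ,$$ where $\tau_0=1$ and $\tau_{2k}=-\sum_{s=0}^{k-1}\dfrac{\tau_{2s}}{2^{2k-2s}(2k-2s+1)!}$ for $k\geq1$. The Lagrange reconstructing polynomial of $f:\mathbb{R}\to\mathbb{R}$ on the equidistant points $x_i+\ell\Delta x$, $\ell\in\{-N_-,\dots,N_+\}$, is $$p_{R_1,N_-,N_+}(x_i+\xi\Delta x;x_i,\Delta x;f)=\sum_{\ell=-N_-}^{N_+}\alpha_{R_1,N_-,N_+,\ell}(\xi)\,f(x_i+\ell\Delta x);$$ it is the unique polynomial of $x=x_i+\xi\Delta x$ whose sliding averages $\frac1{\Delta x}\int_{x-\Delta x/2}^{x+\Delta x/2}p_{R_1,N_-,N_+}(\zeta)\,d\zeta$ equal, for all $x$, the Lagrange interpolating polynomial of $f$ on these points. Let $\nu_{N_-,N_+,m,s}:=\sum_{\ell=-N_-}^{N_+}a^{N_-,N_+}_{m,\ell}\,\ell^s$.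 The error polynomials are, for $s\ge N+1$, $$\mu_{R_1,N_-,N_+,s}(\xi):=\sum_{k=0}^{\lfloor s/2\rfloor}\frac{-\tau_{2k}}{(s-2k)!}\xi^{s-2k}+\sum_{m=0}^{N}\Bigl(\sum_{k=0}^{\lfloor (N-m)/2\rfloor}\tau_{2k}\,\nu_{N_-,N_+,m+2k,s}\frac{(m+2k)!}{s!\,m!}\Bigr)\xi^m,$$ and, for $n\geq N+1$, $$\lambda_{R_1,N_-,N_+,n}(\xi):=\sum_{j=0}^{n-N-1}\mu_{R_1,N_-,N_+,n-j}(\xi)\,\frac{(-1)^{j+1}}{(j+1)!}\Bigl((\xi-\tfrac12)^{j+1}-(\xi+\tfrac12)^{j+1}\Bigr).$$ Relations between the rational functions $\sigma$ without a stated range of $\xi$ are identities of rational functions. *)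

(* Defs.v *)
From HB Require Import structures.
From mathcomp Require Import all_boot all_order all_algebra.
From mathcomp Require Import reals.

Set Implicit Arguments.
Unset Strict Implicit.
Unset Printing Implicit Defensive.

Import Order.TTheory GRing.Theory Num.Theory.
Local Open Scope ring_scope.

(* Only meant for 0 <= Nm + Np, so that absz (Nm + Np) is N. *)

Definition stencil (Nm Np : int) : seq int :=
  [seq - Nm + i%:Z | i <- iota 0 (absz (Nm + Np)).+1].

Section Reconstruction.
Variable R : realFieldType.

Definition alpha_I (Nm Np l : int) : {poly R} :=
  \prod_(k <- stencil Nm Np | k != l) ((l - k)%:~R^-1 *: ('X - (k%:~R)%:P)).

(* [:: tau_0; tau_2; ...; tau_(2 (n - 1))] *)
Fixpoint tau_even_seq (n : nat) : seq R :=
  if n is k.+1 then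
    let t := tau_even_seq k in
    rcons t (if k == 0%N then 1 else
      - \sum_(0 <= s < k)
          t`_s / (2 ^+ (k.*2 - s.*2) * ((k.*2 - s.*2).+1)`!%:R))
  else [::].

(* tau_even k is tau_(2k) *)
Definition tau_even (k : nat) : R := (tau_even_seq k.+1)`_k.

Lemma size_tau_even_seq n : size (tau_even_seq n) = n.
Proof. by elim: n => //= n IHn; rewrite size_rcons IHn. Qed.

Lemma nth_tau_even_seq n k : (k < n)%N -> (tau_even_seq n)`_k = tau_even k.
Proof.
elim: n => // n IHn; rewrite ltnS leq_eqVlt => /predU1P[-> //|lt_kn].
by rewrite [LHS]/= nth_rcons size_tau_even_seq lt_kn IHn.
Qed.

Lemma tau_even0 : tau_even 0 = 1.
Proof. by []. Qed.

Lemma tau_evenE k : (0 < k)%N ->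
  tau_even k = - \sum_(0 <= s < k)
    tau_even s / (2 ^+ (2 * k - 2 * s) * ((2 * k - 2 * s + 1)`!)%:R).
Proof.
move=> k_gt0; rewrite {1}/tau_even /= nth_rcons size_tau_even_seq ltnn eqxx.
rewrite -[k == 0%N]negbK -lt0n k_gt0 /=; congr (- _).
apply: eq_big_nat => s /andP[_ lt_sk].
by rewrite nth_tau_even_seq // addn1 !mul2n.
Qed.

Definition alpha_R1 (Nm Np l : int) : {poly R} :=
  let N := absz (Nm + Np) in
  \poly_(m < N.+1) \sum_(0 <= k < ((N - m)./2).+1)
    tau_even k * ((m + 2 * k)`!)%:R / (m`!)%:R * (alpha_I Nm Np l)`_(m + 2 * k).

(* As a polynomial in the physical variable x = xi + z * dx. *)
Definition p_R1 (Nm Np : int) (xi dx : R) (f : R -> R) : {poly R} :=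
  \sum_(l <- stencil Nm Np)
    f (xi + l%:~R * dx) *: (alpha_R1 Nm Np l \Po (dx^-1 *: ('X - xi%:P))).

Definition nu (Nm Np : int) (m s : nat) : R :=
  \sum_(l <- stencil Nm Np) (alpha_I Nm Np l)`_m * l%:~R ^+ s.

Definition mu_R1 (Nm Np : int) (s : nat) : {poly R} :=
  let N := absz (Nm + Np) in
  \sum_(0 <= k < (s./2).+1)
    (- tau_even k / ((s - 2 * k)`!)%:R) *: 'X^(s - 2 * k) +
  \poly_(m < N.+1) \sum_(0 <= k < ((N - m)./2).+1)
    tau_even k * nu Nm Np (m + 2 * k) s
      * (((m + 2 * k)`!)%:R / ((s`!)%:R * (m`!)%:R)).

Definition lambda_R1 (Nm Np : int) (n : nat) : {poly R} :=
  let N := absz (Nm + Np) in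
  \sum_(0 <= j < n - N)
    mu_R1 Nm Np (n - j) *
    (((-1) ^+ j.+1 / (j.+1`!)%:R) *:
      (('X - (2^-1)%:P) ^+ j.+1 - ('X + (2^-1)%:P) ^+ j.+1)).

End Reconstruction.

Section RationalFunctions.
Variable R : fieldType.

Definition ratfun (p q : {poly R}) : {fraction {poly R}} :=
  FracField.tofrac p / FracField.tofrac q.

(* Value at z, computed on a reduced fraction; 0 at a pole. *)
Definition ratfun_eval (r : {fraction {poly R}}) (z : R) : R :=
  let n := \n_(generic_quotient.repr r) in
  let d := \d_(generic_quotient.repr r) in
  (n %/ gcdp n d).[z] / (d %/ gcdp n d).[z].

Lemma ratfun_repr (r : {fraction {poly R}}) :
  r = ratfun \n_(generic_quotient.repr r) \d_(generic_quotient.repr r).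
Proof.
set x := generic_quotient.repr r.
have dn0 : FracField.tofrac \d_x != 0 by rewrite tofrac_eq0 denom_ratioP.
apply: (mulIf dn0); rewrite /ratfun divfK //.
rewrite -[r in LHS]generic_quotient.reprK -/x.
rewrite /FracField.tofrac; unlock FracField.tofrac.
rewrite -[LHS]FracField.pi_mul; apply/generic_quotient.eqmodP => /=.
rewrite FracField.equivfE /FracField.mulf.
by rewrite !numden_Ratio ?(mulf_neq0, denom_ratioP, oner_neq0) // !mulr1 mulrC.
Qed.

Lemma ratfun_evalE (p q : {poly R}) (z : R) :
  q.[z] != 0 -> ratfun_eval (ratfun p q) z = p.[z] / q.[z].
Proof.
move=> qz0; rewrite /ratfun_eval.
have q0 : q != 0 by apply: contraNneq qz0 => ->; rewrite horner0.
have := ratfun_repr (ratfun p q); set x := generic_quotient.repr _.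
have d0 : \d_x != 0 by exact: denom_ratioP.
set n := \n_x; set d := \d_x; rewrite -/d in d0.
have g0 : gcdp n d != 0 by rewrite gcdp_eq0 negb_and d0 orbT.
move/eqP; rewrite /ratfun eqr_div ?tofrac_eq0 // -!tofracM tofrac_eq => /eqP E.
have cop : coprimep (n %/ gcdp n d) (d %/ gcdp n d).
  by rewrite coprimep_div_gcd // d0 orbT.
have nE := divpK (dvdp_gcdl n d); have dE := divpK (dvdp_gcdr n d).
set n' := n %/ _ in nE cop *; set d' := d %/ _ in dE cop *.
have {}E : p * d' = n' * q.
  by apply: (mulIf g0); rewrite -mulrA dE E -{1}nE mulrAC.
have dq : d' %| q.
  by rewrite -(@Gauss_dvdpr _ _ n') 1?coprimep_sym // -E dvdp_mull.
have dz : d'.[z] != 0.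
  by apply: contraNneq qz0 => dz; rewrite -(divpK dq) hornerM dz mulr0.
by apply/eqP; rewrite eqr_div // -!hornerM -E.
Qed.

End RationalFunctions.

Definition sigma_R1_10 (R : realFieldType) (Mm Mp : int) : {fraction {poly R}} :=
  ratfun (alpha_R1 R Mm Mp (- Mm)) (alpha_R1 R Mm (Mp - 1) (- Mm)).

Definition sigma_R1_11 (R : realFieldType) (Mm Mp : int) : {fraction {poly R}} :=
  ratfun (alpha_R1 R Mm Mp Mp) (alpha_R1 R (Mm - 1) Mp Mp).

(* Main.v *)
(** Let [T] be the linear operator [sum_k tau_(2k) D^(2k)], so that the
    reconstructing polynomials are the images under [T] of the Lagrange
    interpolating ones.  Write [w_S] for the monic polynomial with simple zeros
    on [S], and [L], [R] for the stencil deprived of its last and first point.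
    Newton's formula gives [I_(L u R) f = I_L f + d w_L = I_R f + d w_R] with
    the same divided difference [d]; applying [T] and eliminating [d],
    [(T w_L - T w_R) p = T w_L p_R - T w_R p_L].  Moreover [w_L - w_R] is [M]
    times [w_(L n R)], [lambda] is [- T w_S / M!], and [alpha_(R1)] at an end
    point of a stencil is proportional to [T] of the monic polynomial vanishing
    on the other points.  Uniqueness comes from the data concentrated at the last
    point, for which [p_L] vanishes. *)
Require Import Defs.
From HB Require Import structures.
From mathcomp Require Import all_boot all_order all_algebra.
From mathcomp Require Import reals.
From mathcomp Require Import zify ring.

Import Order.TTheory GRing.Theory Num.Theory.
Local Open Scope ring_scope.

(** * Lagrange and Newton forms of interpolation at integer nodes *)

Section LagrangeBasis.
Variable R : realFieldType.
Implicit Types (s : seq int) (a k l : int) (f : int -> R).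

Definition nodal s : {poly R} := \prod_(k <- s) ('X - (k%:~R)%:P).

Definition lagrange s l : {poly R} :=
  \prod_(k <- s | k != l) ((l - k)%:~R^-1 *: ('X - (k%:~R)%:P)).

Definition bary_weight s l : R := \prod_(k <- s | k != l) (l - k)%:~R^-1.

Definition interp s f : {poly R} := \sum_(l <- s) f l *: lagrange s l.

(** For distinct nodes this is the coefficient of degree [size s - 1] in [interp s f]. *)
Definition divided_diff s f : R := \sum_(l <- s) f l * bary_weight s l.

Lemma bary_weight_neq0 s l : bary_weight s l != 0.
Proof.
rewrite /bary_weight prodf_seq_neq0; apply/allP => k _; apply/implyP => kl.
by rewrite invr_eq0 intr_eq0 subr_eq0 eq_sym.
Qed.

Lemma lagrangeE s l :
  lagrange s l = bary_weight s l *: \prod_(k <- s | k != l) ('X - (k%:~R)%:P).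
Proof. by rewrite /lagrange scaler_prod. Qed.

Lemma size_nodal s : size (nodal s) = (size s).+1.
Proof. by rewrite /nodal size_prod_XsubC. Qed.

Lemma monic_nodal s : nodal s \is monic.
Proof. exact: monic_prod_XsubC. Qed.

Lemma nodal_neq0 s : nodal s != 0.
Proof. exact/monic_neq0/monic_nodal. Qed.

Lemma nodal_cons a s : nodal (a :: s) = ('X - (a%:~R)%:P) * nodal s.
Proof. exact: big_cons. Qed.

Lemma perm_nodal s1 s2 : perm_eq s1 s2 -> nodal s1 = nodal s2.
Proof. exact: perm_big. Qed.

Lemma perm_lagrange s1 s2 l : perm_eq s1 s2 -> lagrange s1 l = lagrange s2 l.
Proof. exact: perm_big. Qed.

Lemma perm_bary_weight s1 s2 l :
  perm_eq s1 s2 -> bary_weight s1 l = bary_weight s2 l.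
Proof. exact: perm_big. Qed.

Lemma perm_interp s1 s2 f : perm_eq s1 s2 -> interp s1 f = interp s2 f.
Proof.
move=> s12; rewrite /interp (perm_big _ s12) /=.
by apply: eq_bigr => l _; rewrite (perm_lagrange _ _ l s12).
Qed.

Lemma perm_divided_diff s1 s2 f :
  perm_eq s1 s2 -> divided_diff s1 f = divided_diff s2 f.
Proof.
move=> s12; rewrite /divided_diff (perm_big _ s12) /=.
by apply: eq_bigr => l _; rewrite (perm_bary_weight _ _ l s12).
Qed.

Lemma nodalD1 s l : uniq s -> l \in s ->
  nodal s = ('X - (l%:~R)%:P) * \prod_(k <- s | k != l) ('X - (k%:~R)%:P).
Proof. by move=> us ls; rewrite /nodal (bigD1_seq l). Qed.

Lemma size_lagrange s l : uniq s -> l \in s -> (size (lagrange s l) <= size s)%N.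
Proof.
move=> us ls; rewrite lagrangeE (leq_trans (size_scale_leq _ _)) //.
have nz : \prod_(k <- s | k != l) ('X - (k%:~R)%:P) != 0 :> {poly R}.
  by rewrite prodf_seq_neq0; apply/allP => k _; rewrite polyXsubC_eq0 implybT.
have := size_nodal s; rewrite (nodalD1 _ l) // size_monicM ?monicXsubC //.
by rewrite size_XsubC add2n => -[->].
Qed.

Lemma lagrange_same s l : (lagrange s l).[l%:~R] = 1.
Proof.
rewrite /lagrange horner_prod big1 // => k kl.
rewrite hornerZ hornerXsubC -rmorphB mulVf // intr_eq0 subr_eq0.
by rewrite eq_sym.
Qed.

Lemma lagrange_other s k l : k \in s -> k != l -> (lagrange s l).[k%:~R] = 0.
Proof.
move=> ks kl; rewrite /lagrange horner_prod; apply/eqP.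
rewrite prodf_seq_eq0; apply/hasP; exists k => //.
by rewrite kl hornerZ hornerXsubC subrr mulr0 eqxx.
Qed.

Lemma horner_interp s f k : uniq s -> k \in s -> (interp s f).[k%:~R] = f k.
Proof.
move=> us ks; rewrite /interp horner_sum (bigD1_seq k) //= hornerZ lagrange_same.
rewrite mulr1 big1 ?addr0 // => l lk.
by rewrite hornerZ lagrange_other ?mulr0 // eq_sym.
Qed.

Lemma size_interp s f : uniq s -> (size (interp s f) <= size s)%N.
Proof.
move=> us; apply: (leq_trans (size_sum _ _ _)); apply/bigmax_leqP_seq => l ls _.
by rewrite (leq_trans (size_scale_leq _ _)) ?size_lagrange.
Qed.

(** Both sides have degree below [size s], the leading terms on the right cancelling, and they agree
    at the [size s] nodes. This is what turns [mu_R1] at the first admissible index into a nodal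
    polynomial. *)
Lemma interp_expn_size s : uniq s ->
  interp s (fun l => l%:~R ^+ size s) = 'X^(size s) - nodal s.
Proof.
move=> us; apply/eqP; rewrite -subr_eq0; apply/eqP.
set q := _ - _.
have sz2 : (size ('X^(size s) - nodal s)%R <= size s)%N.
  apply/leq_sizeP => j; rewrite leq_eqVlt => /predU1P[<-|lt_sj].
    rewrite coefB coefXn eqxx.
    by have /eqP := monic_nodal s; rewrite lead_coefE size_nodal /= => ->; rewrite subrr.
  by rewrite coefB coefXn gtn_eqF // nth_default ?subrr // size_nodal.
have szq : (size q <= size s)%N.
  rewrite (leq_trans (size_polyD _ _)) // size_polyN geq_max sz2 andbT.
  exact: size_interp.
apply: (@roots_geq_poly_eq0 _ _ [seq k%:~R | k <- s]).
- apply/allP => _ /mapP[k ks ->]; rewrite rootE /q !(hornerD, hornerN) hornerXn horner_interp //.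
  by rewrite (nodalD1 _ k) // hornerM hornerXsubC !subrr mul0r oppr0 addr0 subrr.
- by rewrite map_inj_uniq //; apply: intr_inj.
- by rewrite size_map.
Qed.

Lemma bary_weight_cons s a l : l != a ->
  bary_weight (a :: s) l = (l - a)%:~R^-1 * bary_weight s l.
Proof. by move=> la; rewrite /bary_weight big_cons eq_sym la. Qed.

Lemma lagrange_cons_same s a : a \notin s ->
  lagrange (a :: s) a = bary_weight (a :: s) a *: nodal s.
Proof.
move=> as_; rewrite lagrangeE big_cons eqxx /= /nodal; congr (_ *: _).
rewrite [LHS]big_seq_cond [RHS]big_seq; apply: eq_bigl => k.
by case: (boolP (k \in s)) => //= ks; apply: contraNneq as_ => <-.
Qed.

(** The new factor is split as ['X - a = ('X - l) + (l - a)]: the constant cancels the new factor of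
    the weight, and ['X - l] completes the product over the other nodes to [nodal s]. *)
Lemma lagrange_cons s a l : a \notin s -> uniq s -> l \in s ->
  lagrange (a :: s) l = lagrange s l + bary_weight (a :: s) l *: nodal s.
Proof.
move=> as_ us ls; have la : l != a by apply: contraNneq as_ => <-.
rewrite bary_weight_cons // (nodalD1 _ l) // /lagrange big_cons eq_sym la.
rewrite -/(lagrange s l) lagrangeE.
set P := \prod_(k <- s | _) _; set c := bary_weight s l.
have la0 : (l%:~R - a%:~R : R) != 0 by rewrite -rmorphB intr_eq0 subr_eq0.
have -> : 'X - (a%:~R)%:P = ('X - (l%:~R)%:P) + (l%:~R - a%:~R)%:P :> {poly R}.
  by rewrite polyCB; ring.
rewrite scalerDr mulrDl addrC; congr (_ + _).
  by rewrite -mul_polyC -polyCM rmorphB /= mulVf // mul1r.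
by rewrite -!scalerAl -!scalerAr scalerA.
Qed.

(** Newton's formula, by summing the previous decomposition; the basis polynomial of the new node is
    itself a multiple of [nodal s]. *)
Lemma interp_cons s a f : a \notin s -> uniq s ->
  interp (a :: s) f = interp s f + divided_diff (a :: s) f *: nodal s.
Proof.
move=> as_ us; rewrite /interp /divided_diff !big_cons scalerDl lagrange_cons_same //.
rewrite scalerA addrCA; congr (_ + _); rewrite scaler_suml -big_split /=.
rewrite [LHS]big_seq [RHS]big_seq; apply: eq_bigr => l ls.
by rewrite lagrange_cons // scalerDr scalerA.
Qed.

Lemma interp_rcons s a f : a \notin s -> uniq s ->
  interp (rcons s a) f = interp s f + divided_diff (rcons s a) f *: nodal s.
Proof.
move=> as_ us; have p : perm_eq (rcons s a) (a :: s) by rewrite perm_rcons.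
by rewrite (perm_interp _ _ f p) (perm_divided_diff _ _ f p) interp_cons.
Qed.

End LagrangeBasis.

(** * The operator taking interpolating polynomials to reconstructing ones *)

Section ReconstructionOperator.
Variable R : realFieldType.
Implicit Types p q : {poly R}.

(* The truncation at order [2 n] is harmless on polynomials of degree at most
   [2 n + 1]. *)
Definition recon n p : {poly R} :=
  \sum_(0 <= k < n.+1) tau_even R k *: p^`(2 * k).

Lemma reconD n p q : recon n (p + q) = recon n p + recon n q.
Proof.
rewrite /recon -big_split; apply: eq_bigr => k _.
by rewrite /= derivnD scalerDr.
Qed.

Lemma reconZ n c p : recon n (c *: p) = c *: recon n p.
Proof.
rewrite /recon scaler_sumr; apply: eq_bigr => k _.
by rewrite derivnZ !scalerA mulrC.
Qed.

Lemma reconN n p : recon n (- p) = - recon n p.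
Proof. by rewrite -scaleN1r reconZ scaleN1r. Qed.

Lemma recon_sum n (I : Type) (r : seq I) (F : I -> {poly R}) :
  recon n (\sum_(i <- r) F i) = \sum_(i <- r) recon n (F i).
Proof.
apply: (big_morph (recon n) (reconD n)).
by rewrite -[0](scale0r 0) reconZ !scale0r.
Qed.

Lemma coef_recon n p m : (recon n p)`_m =
  \sum_(0 <= k < n.+1)
    tau_even R k * ((m + 2 * k)`!)%:R / (m`!)%:R * p`_(m + 2 * k).
Proof.
rewrite /recon coef_sum; apply: eq_bigr => k _.
have fm : (m`!)%:R != 0 :> R by rewrite pnatr_eq0 -lt0n fact_gt0.
rewrite coefZ coef_derivn [(2 * k + m)%N]addnC -mulr_natr.
have := ffact_fact (leq_addl m (2 * k)%N); rewrite addnK => <-.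
by rewrite natrM; field.
Qed.

(** Only the term [k = 0] reaches the top degree, and its coefficient is 1. Hence [recon n] kills no
    nonzero polynomial, which makes the denominators below nonzero. *)
Lemma lead_coef_recon n p : (recon n p)`_(size p).-1 = lead_coef p.
Proof.
rewrite coef_recon big_nat_recl // muln0 addn0 tau_even0 mul1r divff ?mul1r; last first.
  by rewrite pnatr_eq0 -lt0n fact_gt0.
rewrite big1 ?addr0 // => k _.
by rewrite [X in _ * X]nth_default ?mulr0 //=; lia.
Qed.

Lemma recon_neq0 n p : p != 0 -> recon n p != 0.
Proof.
rewrite -lead_coef_eq0; apply: contraNneq => q0.
by rewrite -(lead_coef_recon n) q0 coef0.
Qed.

(** The two sides differ only by terms whose coefficient of [p] has index above [N], hence is zero.
    A single order [n] can therefore serve stencils of different lengths. *)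
Lemma poly_reconE n N p : (size p <= N.+1)%N -> (N <= n)%N ->
  \poly_(m < N.+1) \sum_(0 <= k < ((N - m)./2).+1)
    tau_even R k * ((m + 2 * k)`!)%:R / (m`!)%:R * p`_(m + 2 * k) = recon n p.
Proof.
move=> szp leNn; apply/polyP => m; rewrite coef_poly coef_recon.
case: ifP => [ltmN|/negbT]; last first.
  rewrite -leqNgt => leNm; rewrite big1 // => k _.
  by rewrite [X in _ * X]nth_default ?mulr0 //; apply: leq_trans szp _; lia.
rewrite [RHS](@big_cat_nat _ _ _ ((N - m)./2).+1) //=; last by lia.
rewrite [X in _ + X]big_nat_cond [X in _ + X]big1 ?addr0 // => k /andP[/andP[lek _] _].
by rewrite [X in _ * X]nth_default ?mulr0 //; apply: leq_trans szp _; lia.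
Qed.

(** Derivatives of order [2 * k > s] kill ['X^s]; the others bring the falling factorial, and
    dividing it by [s!] leaves [1 / (s - 2 * k)!]. *)
Lemma recon_Xn n s : (s <= n)%N ->
  \sum_(0 <= k < (s./2).+1) (- tau_even R k / ((s - 2 * k)`!)%:R) *: 'X^(s - 2 * k)
  = - ((s`!)%:R^-1 *: recon n 'X^s).
Proof.
move=> lesn; rewrite /recon [in RHS](@big_cat_nat _ _ _ (s./2).+1) //=; last by lia.
rewrite [X in _ + X]big_nat_cond [X in _ + X]big1 ?addr0; last first.
  move=> k /andP[/andP[lek _] _].
  by rewrite derivnXn ffact_small ?mulr0n ?scaler0 //; lia.
rewrite scaler_sumr -sumrN; apply: eq_big_nat => k /andP[_ ltk].
have le2k : (2 * k <= s)%N by lia.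
have f0 i : (i`!)%:R != 0 :> R by rewrite pnatr_eq0 -lt0n fact_gt0.
rewrite derivnXn -scaler_nat !scalerA -scaleNr; congr (_ *: _).
rewrite -(ffact_fact le2k) natrM.
have : (s ^_ (2 * k))%:R != 0 :> R by rewrite pnatr_eq0 -lt0n ffact_gt0.
by move=> ?; field; rewrite f0.
Qed.

End ReconstructionOperator.

(** * Stencils as lists of nodes *)

Lemma size_stencil (Nm Np : int) : size (stencil Nm Np) = (absz (Nm + Np)).+1.
Proof. by rewrite size_map size_iota. Qed.

Lemma stencil_uniq (Nm Np : int) : uniq (stencil Nm Np).
Proof. by rewrite map_inj_uniq ?iota_uniq // => i j /addrI[]. Qed.

Lemma stencil_cons (Nm Np : int) : 0 < Nm + Np ->
  stencil Nm Np = - Nm :: stencil (Nm - 1) Np.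
Proof.
move=> N0; rewrite /stencil.
have -> : absz (Nm + Np) = (absz (Nm - 1 + Np)).+1 by lia.
have iotaS n : iota 0 n.+1 = 0%N :: iota (1 + 0) n by [].
rewrite iotaS map_cons addr0 iotaDl -map_comp.
by congr (_ :: _); apply: eq_map => i /=; lia.
Qed.

Lemma stencil_rcons (Nm Np : int) : 0 < Nm + Np ->
  stencil Nm Np = rcons (stencil Nm (Np - 1)) Np.
Proof.
move=> N0; rewrite /stencil.
have -> : absz (Nm + Np) = (absz (Nm + (Np - 1))).+1 by lia.
rewrite -[in LHS](addn1 (absz _).+1) iotaD map_cat -cats1 add0n.
by congr (_ ++ _); rewrite /=; congr [:: _]; lia.
Qed.

(** * The reconstruction polynomials as images under [recon] *)

Section StencilReconstruction.
Variable R : realFieldType.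
Implicit Types (Nm Np l : int) (n s : nat).

Lemma alpha_R1E n Nm Np l : (absz (Nm + Np)%R <= n)%N -> l \in stencil Nm Np ->
  alpha_R1 R Nm Np l = recon R n (lagrange R (stencil Nm Np) l).
Proof.
move=> leNn ls; apply: poly_reconE => //.
by rewrite -size_stencil size_lagrange ?stencil_uniq.
Qed.

(** The numbers [nu] are the coefficients of the interpolant of the [s]-th power, so the two sums in
    [mu_R1] combine into the image of an interpolation error. *)
Lemma mu_R1E n Nm Np s : (absz (Nm + Np)%R <= n)%N -> (s <= n)%N ->
  mu_R1 R Nm Np s = (s`!)%:R^-1 *:
    recon R n (interp R (stencil Nm Np) (fun l => l%:~R ^+ s) - 'X^s).
Proof.
move=> leNn lesn; rewrite /mu_R1 (recon_Xn _ _ _ lesn) reconD reconN scalerBr addrC.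
congr (_ - _).
rewrite -(@poly_reconE _ n (absz (Nm + Np))) //; last first.
  by rewrite -size_stencil size_interp ?stencil_uniq.
have f0 i : (i`!)%:R != 0 :> R by rewrite pnatr_eq0 -lt0n fact_gt0.
apply/polyP => m; rewrite coefZ !coef_poly; case: ifP => _; last by rewrite mulr0.
rewrite mulr_sumr; apply: eq_bigr => k _.
have -> : nu R Nm Np (m + 2 * k) s =
    (interp R (stencil Nm Np) (fun l => l%:~R ^+ s))`_(m + 2 * k).
  by rewrite coef_sum; apply: eq_bigr => l _; rewrite coefZ mulrC.
by field; rewrite !f0.
Qed.

Lemma lambda_R1_succ Nm Np n : n = (absz (Nm + Np)).+1 ->
  lambda_R1 R Nm Np n = - ((n`!)%:R^-1 *: recon R n (nodal R (stencil Nm Np))).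
Proof.
move=> nE; rewrite /lambda_R1; have -> : (n - absz (Nm + Np)%R = 1)%N by lia.
rewrite big_nat1 subn0 (@mu_R1E n) //; last by lia.
have szn : n = size (stencil Nm Np) by rewrite size_stencil.
rewrite [X in interp _ _ (fun l => _ ^+ X)]szn [X in 'X^X]szn.
rewrite interp_expn_size ?stencil_uniq // addrC addKr reconN scalerN.
(* Only [j = 0] is left in the sum, and its second factor is the constant 1. *)
have -> : ((-1) ^+ 1 / (1`!)%:R : R) *: (('X - (2^-1)%:P) ^+ 1 - ('X + (2^-1)%:P) ^+ 1)
   = 1 :> {poly R}.
  rewrite !expr1 divr1 scaleN1r opprB opprB addrC addrA subrK -polyCD.
  by rewrite (_ : 2^-1 + 2^-1 = 1 :> R) //; field.
by rewrite mulr1.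
Qed.

(** The substitution undoes the rescaling in [p_R1], giving a polynomial in the reduced variable, on
    which [recon] acts. *)
Lemma p_R1_comp n Nm Np (xi dx : R) (f : R -> R) :
  (absz (Nm + Np)%R <= n)%N -> dx != 0 ->
  p_R1 Nm Np xi dx f \Po (xi%:P + dx *: 'X) =
    recon R n (interp R (stencil Nm Np) (fun l => f (xi + l%:~R * dx))).
Proof.
move=> leNn dx0; rewrite /p_R1 /interp recon_sum.
rewrite (raddf_sum (comp_poly _)) [LHS]big_seq [RHS]big_seq.
apply: eq_bigr => l ls; rewrite reconZ /= comp_polyZ -comp_polyA.
rewrite comp_polyZ comp_polyB comp_polyX comp_polyC addrAC subrr add0r.
by rewrite scalerA mulVf // scale1r comp_polyXr (@alpha_R1E n).
Qed.


(** * The full stencil and its two substencils with one end point removed *)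

Section AdjacentStencils.
Variables (Mm Mp : int).
Hypothesis M_ge2 : 2 <= Mm + Mp.
Let M := absz (Mm + Mp).
Let w S := recon R M (nodal R S).
Let wL := w (stencil Mm (Mp - 1)).
Let wR := w (stencil (Mm - 1) Mp).
Let w0 := w (stencil (Mm - 1) (Mp - 1)).
Let bL := bary_weight R (stencil Mm (Mp - 1)) (- Mm).
Let bR := bary_weight R (stencil (Mm - 1) Mp) Mp.

Let stencilE : stencil Mm Mp = - Mm :: stencil (Mm - 1) Mp.
Proof. by apply: stencil_cons; lia. Qed.

Let stencilEr : stencil Mm Mp = rcons (stencil Mm (Mp - 1)) Mp.
Proof. by apply: stencil_rcons; lia. Qed.

Let stencilLE : stencil Mm (Mp - 1) = - Mm :: stencil (Mm - 1) (Mp - 1).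
Proof. by apply: stencil_cons; lia. Qed.

Let stencilRE : stencil (Mm - 1) Mp = rcons (stencil (Mm - 1) (Mp - 1)) Mp.
Proof. by apply: stencil_rcons; lia. Qed.

Let Mm_notinR : - Mm \notin stencil (Mm - 1) Mp.
Proof. by have := stencil_uniq Mm Mp; rewrite stencilE => /andP[]. Qed.

Let Mp_notinL : Mp \notin stencil Mm (Mp - 1).
Proof. by have := stencil_uniq Mm Mp; rewrite stencilEr rcons_uniq => /andP[]. Qed.

Let Mm_notin0 : - Mm \notin stencil (Mm - 1) (Mp - 1).
Proof. by have := stencil_uniq Mm (Mp - 1); rewrite stencilLE => /andP[]. Qed.

Let Mp_notin0 : Mp \notin stencil (Mm - 1) (Mp - 1).
Proof.
by have := stencil_uniq (Mm - 1) Mp; rewrite stencilRE rcons_uniq => /andP[].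
Qed.

Let MR : (Mm + Mp)%:~R = M%:R :> R.
Proof. by rewrite /M -[in LHS](gez0_abs (_ : 0 <= Mm + Mp)) ?pmulrn //; lia. Qed.

(** The two nodal polynomials share the interior factor; the remaining factors ['X + Mm] and
    ['X - Mp] differ by the constant [Mm + Mp]. *)
Lemma recon_nodal_sub : wL - wR = M%:R *: w0.
Proof.
rewrite -reconN -reconD -reconZ; congr (recon R M _).
rewrite stencilLE stencilRE nodal_cons.
rewrite (@perm_nodal _ (rcons _ _) (Mp :: stencil (Mm - 1) (Mp - 1))) ?perm_rcons //.
rewrite nodal_cons -mulrBl -MR -mul_polyC; congr (_ * _).
by rewrite rmorphD rmorphN /= polyCD polyCN; ring.
Qed.

(** Compared with [bL], the weight on the full stencil has the extra factor [1 / (- Mm - Mp)],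
    whence the sign and the division by [M]. *)
Lemma alpha_R1_first : alpha_R1 R Mm Mp (- Mm) = - (bL / M%:R) *: wR.
Proof.
rewrite (@alpha_R1E M) ?stencilE ?mem_head // lagrange_cons_same // reconZ.
rewrite -stencilE (@perm_bary_weight _ _ (Mp :: stencil Mm (Mp - 1))); last first.
  by rewrite stencilEr perm_rcons.
rewrite bary_weight_cons; last by lia.
have -> : - Mm - Mp = - (Mm + Mp) by lia.
by rewrite rmorphN /= MR invrN mulNr mulrC.
Qed.

Lemma alpha_R1_last : alpha_R1 R Mm Mp Mp = (bR / M%:R) *: wL.
Proof.
have p : perm_eq (stencil Mm Mp) (Mp :: stencil Mm (Mp - 1)).
  by rewrite stencilEr perm_rcons.
rewrite (@alpha_R1E M) ?(perm_mem p) ?mem_head //.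
rewrite (perm_lagrange _ _ _ _ p) lagrange_cons_same // reconZ.
rewrite -(perm_bary_weight _ _ _ _ p) stencilE bary_weight_cons; last by lia.
by rewrite opprK addrC MR mulrC.
Qed.

Lemma alpha_R1_left_first : alpha_R1 R Mm (Mp - 1) (- Mm) = bL *: w0.
Proof.
rewrite (@alpha_R1E M) ?stencilLE ?mem_head //; last by lia.
by rewrite lagrange_cons_same // reconZ /bL stencilLE.
Qed.

Lemma alpha_R1_right_last : alpha_R1 R (Mm - 1) Mp Mp = bR *: w0.
Proof.
have p : perm_eq (stencil (Mm - 1) Mp) (Mp :: stencil (Mm - 1) (Mp - 1)).
  by rewrite stencilRE perm_rcons.
rewrite (@alpha_R1E M) ?(perm_mem p) ?mem_head //; last by lia.
rewrite (perm_lagrange _ _ _ _ p) lagrange_cons_same // reconZ.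
by rewrite -(perm_bary_weight _ _ _ _ p).
Qed.

Lemma lambda_R1_left : lambda_R1 R Mm (Mp - 1) M = - ((M`!)%:R^-1 *: wL).
Proof. by apply: lambda_R1_succ; lia. Qed.

Lemma lambda_R1_right : lambda_R1 R (Mm - 1) Mp M = - ((M`!)%:R^-1 *: wR).
Proof. by apply: lambda_R1_succ; lia. Qed.

Lemma p_R1_comp_combine (xi dx : R) (f : R -> R) : dx != 0 ->
  let x := xi%:P + dx *: 'X in
  (wL - wR) * (p_R1 Mm Mp xi dx f \Po x) =
    wL * (p_R1 (Mm - 1) Mp xi dx f \Po x) - wR * (p_R1 Mm (Mp - 1) xi dx f \Po x).
Proof.
move=> dx0 x; rewrite !(@p_R1_comp M) //; [|lia..].
set g := fun l : int => _; set d := divided_diff R (stencil Mm Mp) g.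
have EL : recon R M (interp R (stencil Mm Mp) g) =
    recon R M (interp R (stencil Mm (Mp - 1)) g) + d *: wL.
  by rewrite /d stencilEr interp_rcons ?stencil_uniq // reconD reconZ.
have ER : recon R M (interp R (stencil Mm Mp) g) =
    recon R M (interp R (stencil (Mm - 1) Mp) g) + d *: wR.
  by rewrite /d stencilE interp_cons ?stencil_uniq // reconD reconZ.
(* The product with [wL] is expanded by [ER] and the one with [wR] by [EL], so that the two terms
   [d * wL * wR] cancel. *)
rewrite mulrBl {1}ER EL -!mul_polyC; ring.
Qed.

(** Test data for uniqueness: the point [Mp] is missing from the left stencil, so only the weight of
    the right one survives. *)
Lemma p_R1_delta_last (z : R) :
  let f x : R := (x == Mp%:~R)%:R in
  [/\ (p_R1 Mm Mp 0 1 f).[0 + z * 1] = (alpha_R1 R Mm Mp Mp).[z],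
      (p_R1 (Mm - 1) Mp 0 1 f).[0 + z * 1] = (alpha_R1 R (Mm - 1) Mp Mp).[z]
    & (p_R1 Mm (Mp - 1) 0 1 f).[0 + z * 1] = 0].
Proof.
move=> f; have fE l : f (0 + l%:~R * 1) = (l == Mp)%:R.
  by rewrite add0r mulr1 /f eqr_int.
have H Nm Np : (p_R1 Nm Np 0 1 f).[0 + z * 1] =
    if Mp \in stencil Nm Np then (alpha_R1 R Nm Np Mp).[z] else 0.
  have -> : (p_R1 Nm Np 0 1 f).[0 + z * 1] =
      \sum_(l <- stencil Nm Np) (l == Mp)%:R * (alpha_R1 R Nm Np l).[z].
    rewrite /p_R1 horner_sum; apply: eq_bigr => l _.
    by rewrite hornerZ horner_comp fE invr1 scale1r subr0 hornerX add0r mulr1.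
  case: ifPn => [Mps|/negP Mps].
    rewrite (bigD1_seq Mp) ?stencil_uniq //= eqxx mul1r big1 ?addr0 // => l /negPf->.
    by rewrite mul0r.
  rewrite big_seq big1 // => l ls; case: eqP ls => [-> //|_ _].
  by rewrite mul0r.
split; rewrite H.
- by rewrite stencilEr mem_rcons mem_head.
- by rewrite stencilRE mem_rcons mem_head.
- by rewrite (negPf Mp_notinL).
Qed.

End AdjacentStencils.

End StencilReconstruction.

(** * The rational weights, the recombination and its uniqueness *)

Lemma ratfunZ (F : fieldType) (c : F) (p q : {poly F}) : c != 0 ->
  ratfun (c *: p) (c *: q) = ratfun p q.
Proof.
move=> c0; rewrite /ratfun -!mul_polyC !tofracM -mulf_div divff ?mul1r //.
by rewrite tofrac_eq0 polyC_eq0.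
Qed.

Theorem lemma4p2 (R : realType) (Mm Mp : int) (hM : 2 <= Mm + Mp) :
  let M := absz (Mm + Mp) in
  let alphaL := alpha_R1 R Mm (Mp - 1) (- Mm) in
  let alphaR := alpha_R1 R (Mm - 1) Mp Mp in
  let lamL := lambda_R1 R Mm (Mp - 1) M in
  let lamR := lambda_R1 R (Mm - 1) Mp M in
  let sigma0 := sigma_R1_10 R Mm Mp in
  let sigma1 := sigma_R1_11 R Mm Mp in
  (* the quotients below have nonzero denominators *)
  [/\ alphaL != 0, alphaR != 0 & lamR - lamL != 0] /\
  (* (a) *)
  (sigma0 = ratfun lamR (lamR - lamL) /\
   sigma1 = ratfun lamL (lamL - lamR)) /\
  (* (b) *)
  sigma0 + sigma1 = 1 /\
  (* (c) *)
  (forall (xi dx : R) (f : R -> R), 0 < dx ->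
     let x := xi%:P + dx *: 'X in
     let num := lamR * (p_R1 Mm (Mp - 1) xi dx f \Po x)
                - lamL * (p_R1 (Mm - 1) Mp xi dx f \Po x) in
     let den := lamR - lamL in
     den %| num /\
     forall z : R, (p_R1 Mm Mp xi dx f).[xi + z * dx] = (num %/ den).[z]) /\
  (* (d) *)
  (forall z : R, alphaR.[z] != 0 ->
     alphaL.[z] != 0 /\
     forall (xi dx : R) (f : R -> R), 0 < dx ->
       (p_R1 Mm Mp xi dx f).[xi + z * dx] =
         ratfun_eval sigma0 z * (p_R1 Mm (Mp - 1) xi dx f).[xi + z * dx]
         + ratfun_eval sigma1 z * (p_R1 (Mm - 1) Mp xi dx f).[xi + z * dx]) /\
  (* (e) *)
  (forall s0 s1 : R -> R,
     (forall z : R, alphaR.[z] != 0 -> s0 z + s1 z = 1) ->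
     (forall z : R, alphaR.[z] != 0 ->
        forall (xi dx : R) (f : R -> R), 0 < dx ->
          (p_R1 Mm Mp xi dx f).[xi + z * dx] =
            s0 z * (p_R1 Mm (Mp - 1) xi dx f).[xi + z * dx]
            + s1 z * (p_R1 (Mm - 1) Mp xi dx f).[xi + z * dx]) ->
     forall z : R, alphaR.[z] != 0 ->
       s0 z = ratfun_eval sigma0 z /\ s1 z = ratfun_eval sigma1 z).
Proof.
move=> M alphaL alphaR lamL lamR sigma0 sigma1.
pose wL := recon R M (nodal R (stencil Mm (Mp - 1))).
pose wR := recon R M (nodal R (stencil (Mm - 1) Mp)).
pose w0 := recon R M (nodal R (stencil (Mm - 1) (Mp - 1))).
pose bL := bary_weight R (stencil Mm (Mp - 1)) (- Mm).
pose bR := bary_weight R (stencil (Mm - 1) Mp) Mp.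
pose c : R := (M`!)%:R^-1.
have M0 : M%:R != 0 :> R by rewrite pnatr_eq0 /M; lia.
have c0 : c != 0 by rewrite invr_eq0 pnatr_eq0 -lt0n fact_gt0.
have w00 : w0 != 0 by rewrite recon_neq0 ?nodal_neq0.
have bL0 : bL != 0 by exact: bary_weight_neq0.
have bR0 : bR != 0 by exact: bary_weight_neq0.
have EL : alphaL = bL *: w0 by exact: alpha_R1_left_first.
have ER : alphaR = bR *: w0 by exact: alpha_R1_right_last.
have wB : wL - wR = M%:R *: w0 by exact: recon_nodal_sub.
have wB0 : wL - wR != 0 by rewrite wB scale_poly_eq0 negb_or M0.
have lamLE : lamL = - (c *: wL) by exact: lambda_R1_left.
have lamRE : lamR = - (c *: wR) by exact: lambda_R1_right.
have denE : lamR - lamL = c *: (wL - wR).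
  by rewrite lamLE lamRE opprK addrC -scalerBr.
have den0 : lamR - lamL != 0 by rewrite denE scale_poly_eq0 negb_or c0.
(* Both weights are brought to the common denominator [wL - wR]; here the scalar [bL / M%:R] cancels
   between numerator and denominator. *)
have s0E : sigma0 = ratfun (- wR) (wL - wR).
  rewrite /sigma0 /sigma_R1_10 -/alphaL EL alpha_R1_first //.
  rewrite -[RHS](@ratfunZ _ (bL / M%:R)) ?mulf_neq0 ?invr_eq0 //.
  by rewrite wB scalerN scaleNr scalerA divfK.
have s1E : sigma1 = ratfun wL (wL - wR).
  rewrite /sigma1 /sigma_R1_11 -/alphaR ER alpha_R1_last //.
  rewrite -[RHS](@ratfunZ _ (bR / M%:R)) ?mulf_neq0 ?invr_eq0 //.
  by rewrite wB scalerA divfK.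
have sD : sigma0 + sigma1 = 1.
  rewrite s0E s1E /ratfun -mulrDl -tofracD addrC divff //.
  by rewrite tofrac_eq0.
(* [alphaL], [alphaR] and [wL - wR] are all nonzero multiples of [w0], so excluding the zeros of
   [alphaR] avoids every pole. *)
have evalz z : alphaR.[z] != 0 -> (wL - wR).[z] != 0.
  rewrite ER wB !hornerZ !mulf_eq0 !negb_or => /andP[_ ->].
  by rewrite M0.
have horner_p Nm Np (xi dx : R) (f : R -> R) z :
    (p_R1 Nm Np xi dx f).[xi + z * dx]
    = (p_R1 Nm Np xi dx f \Po (xi%:P + dx *: 'X)).[z].
  by rewrite horner_comp !hornerE mulrC.
split; first by split; rewrite // ?EL ?ER scale_poly_eq0 negb_or ?bL0 ?bR0.
split.
  split; first by rewrite denE lamRE s0E -scalerN ratfunZ.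
  by rewrite -opprB denE lamLE s1E -!scaleNr ratfunZ ?oppr_eq0.
split; first exact: sD.
split; last split.
- move=> xi dx f dx0 x num den.
  (* The division is exact because the numerator is visibly a multiple of [den]. *)
  have numE : num = den * (p_R1 Mm Mp xi dx f \Po x).
    rewrite /den denE -scalerAl (p_R1_comp_combine _ _ _ hM) ?gt_eqF //.
    by rewrite /num lamLE lamRE !mulNr opprK addrC -!scalerAl -scalerBr.
  rewrite numE; split; first by rewrite dvdp_mulr.
  by move=> z; rewrite mulKp // horner_p.
- move=> z az0; split.
    move: az0; rewrite EL ER !hornerZ !mulf_eq0 !negb_or => /andP[_ ->].
    by rewrite bL0.
  move=> xi dx f dx0; have wz0 := evalz z az0.
  rewrite s0E s1E !ratfun_evalE // !horner_p.
  have := p_R1_comp_combine _ _ _ hM xi _ f (lt0r_neq0 dx0).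
  move/(congr1 (horner^~ z)); rewrite -/wL -/wR !(hornerD, hornerN, hornerM) => E.
  rewrite !(hornerD, hornerN) in wz0 *.
  by apply: (mulfI wz0); rewrite E; field.
- move=> s0 s1 sB sp z az0.
  have wz0 := evalz z az0.
  have [EM E1 E0] := p_R1_delta_last R _ _ hM z.
  (* With data concentrated at [Mp] the term in [s0] disappears, which determines [s1 z]; then
     [s0 z] follows from the sum being 1. *)
  have := sp z az0 0 1 _ ltr01; move/(_ (fun x => (x == Mp%:~R)%:R)).
  rewrite EM E1 E0 mulr0 add0r -/alphaR => E.
  have s1z : s1 z = ratfun_eval sigma1 z.
    by rewrite /sigma1 /sigma_R1_11 ratfun_evalE // E mulfK.
  split=> //; apply/(addIr (s1 z)); rewrite sB // s1z.
  by rewrite s0E s1E !ratfun_evalE // -mulrDl -hornerD addrC divff.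
Qed.
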